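(* The following problem is undecidable: given a finite alphabet $\Sigma$ and a $\mathsf{C\text{-}RASP}$ program $\phi$ over $\Sigma$, decide whether $L(\phi)=\emptyset$.
   Context: $\mathsf{C\text{-}RASP}$ formulas over a finite alphabet $\Sigma$ are given by the grammar $\phi ::= \sigma \mid \Diamond^{-}\phi \mid \Box^{-}\phi \mid \neg\phi \mid \phi_1\wedge\phi_2 \mid \sum_{t\in\mathcal{T}}\alpha_t t\sim k$, with terms $t ::= \#[\phi] \mid c$, where $\sigma\in\Sigma$, $\alpha_t,k,c\in\mathbb{Z}$, $\mathcal T$ is a finite set of terms, and ${\sim}\in\{<,\le,=,\ge,>\}$. For a string $w=w_1\cdots w_n$ and a position $i\in[1,n]$: $w,i\models\sigma$ iff $w_i=\sigma$; $\neg$ and $\wedge$ have their usual meaning; $w,i\models\Diamond^{-}\phi$ iff $w,j\models\phi$ for some $j<i$; $w,i\models\Box^{-}\phi$ iff $w,j\models\phi$ for all $j\le i$; the term $\#[\phi]$ evaluates at $(w,i)$ to $|\{j\in[1,i] : w,j\models\phi\}|$ and the term $c$ to $c$; $w,i\models\sum_t\alpha_t t\sim k$ iff the resulting integer comparison holds. We write $w\models\phi$ iff $w,|w|\models\phi$, and $L(\phi)=\{w\in\Sigma^*: w\models\phi\}$. A program is a straight-line (DAG) representation $(\phi_1,\dots,\phi_n)$ in which each $\phi_i$ may refer to earlier $\phi_j$ ($j<i$); it denotes $\phi_n$. *)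

(* Defs.v *)
From mathcomp Require Import all_boot all_order all_algebra.
Set Implicit Arguments. Unset Strict Implicit. Unset Printing Implicit Defensive.
Import Order.TTheory GRing.Theory Num.Theory.

(* C-RASP programs over the alphabet Sigma = {0, ..., k-1}.           *)
(* A program is a non-empty list of nodes phi_0, ..., phi_{m-1}; node *)
(* j may refer (by index) only to nodes j' < j; it denotes its last   *)
(* node.                                                              *)

Inductive cmpop := CLt | CLe | CEq | CGe | CGt.

Inductive cterm :=
  | TCount of nat
  | TConst of int.

Inductive node :=
  | NLetter of nat
  | NDiamond of nat
  | NBox of nat
  | NNot of nat
  | NAnd of nat & nat
  | NCmp of seq (int * cterm) & cmpop & int.

Definition program := seq node.

Definition term_ok (j : nat) (t : cterm) : bool :=
  if t is TCount j' then j' < j else true.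

Definition node_ok (k j : nat) (nd : node) : bool :=
  match nd with
  | NLetter a => a < k
  | NDiamond j' | NBox j' | NNot j' => j' < j
  | NAnd j1 j2 => (j1 < j) && (j2 < j)
  | NCmp ts _ _ => all (fun tc => term_ok j tc.2) ts
  end.

Definition wf_program (k : nat) (p : program) : bool :=
  (0 < size p) && all (fun j => node_ok k j (nth (NLetter 0) p j)) (iota 0 (size p)).

Definition cmp_eval (c : cmpop) (x y : int) : bool :=
  match c with
  | CLt => x < y | CLe => x <= y | CEq => x == y | CGe => x >= y | CGt => x > y
  end%R.

(* Semantics: each node is evaluated as a function position -> bool.
   Positions are 1..|w|; letter w_i is nth 0 w (i-1). *)
Section Eval.
Variable w : seq nat.
Variable env : seq (nat -> bool).
Definition getv (j : nat) : nat -> bool := nth (fun _ => false) env j.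

Definition term_eval (t : cterm) (i : nat) : int :=
  match t with
  | TCount j => (count (getv j) (iota 1 i))%:Z
  | TConst c => c
  end.

Definition node_eval (nd : node) : nat -> bool :=
  match nd with
  | NLetter a => fun i => (0 < i) && (i <= size w) && (nth 0 w i.-1 == a)
  | NDiamond j => fun i => has (getv j) (iota 1 i.-1)
  | NBox j => fun i => all (getv j) (iota 1 i)
  | NNot j => fun i => ~~ getv j i
  | NAnd j1 j2 => fun i => getv j1 i && getv j2 i
  | NCmp ts c k => fun i =>
      cmp_eval c (\sum_(tc <- ts) (tc.1 * term_eval tc.2 i))%R k
  end.
End Eval.

Definition program_env (p : program) (w : seq nat) : seq (nat -> bool) :=
  foldl (fun env nd => rcons env (node_eval w env nd)) [::] p.

Definition accepts (p : program) (w : seq nat) : bool :=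
  last (fun _ => false) (program_env p w) (size w).

Definition lang_empty (k : nat) (p : program) : Prop :=
  forall w : seq 'I_k, ~~ accepts p (map val w).

Definition npair (m n : nat) : nat := ((m + n) * (m + n).+1) %/ 2 + n.

Definition enc_int (z : int) : nat :=
  match z with Posz n => n.*2 | Negz n => n.*2.+1 end.

Fixpoint enc_list (T : Type) (e : T -> nat) (s : seq T) : nat :=
  match s with [::] => 0 | x :: s' => (npair (e x) (enc_list e s')).+1 end.

Definition enc_cmp (c : cmpop) : nat :=
  match c with CLt => 0 | CLe => 1 | CEq => 2 | CGe => 3 | CGt => 4 end.

Definition enc_term (t : cterm) : nat :=
  match t with TCount j => npair 0 j | TConst c => npair 1 (enc_int c) end.

Definition enc_node (nd : node) : nat :=
  match nd with
  | NLetter a => npair 0 a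
  | NDiamond j => npair 1 j
  | NBox j => npair 2 j
  | NNot j => npair 3 j
  | NAnd j1 j2 => npair 4 (npair j1 j2)
  | NCmp ts c k =>
      npair 5 (npair (enc_list (fun tc => npair (enc_int tc.1) (enc_term tc.2)) ts)
                     (npair (enc_cmp c) (enc_int k)))
  end.

Definition enc_instance (k : nat) (p : program) : nat :=
  npair k (enc_list enc_node p).

Inductive instr :=
  | Inc of nat
  | Dec of nat & nat.

Definition rm := seq instr.
Definition rstate := (nat * (nat -> nat))%type.

Definition upd (f : nat -> nat) (r v : nat) : nat -> nat :=
  fun r' => if r' == r then v else f r'.

Definition rm_step (M : rm) (s : rstate) : rstate :=
  let: (pc, regs) := s in
  if pc < size M then
    match nth (Inc 0) M pc with
    | Inc r => (pc.+1, upd regs r (regs r).+1)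
    | Dec r j => if regs r == 0 then (j, regs) else (pc.+1, upd regs r (regs r).-1)
    end
  else s.

Definition rm_run (M : rm) (n : nat) (s : rstate) : rstate := iter n (rm_step M) s.

Definition rm_halted (M : rm) (s : rstate) : bool := size M <= s.1.

Definition rm_init (x : nat) : rstate := (0, fun r => if r == 0 then x else 0).

Definition rm_decides (X : Type) (enc : X -> nat) (D : X -> Prop) (P : X -> Prop)
    (M : rm) : Prop :=
  forall x, D x -> exists n,
    let s := rm_run M n (rm_init (enc x)) in
    rm_halted M s /\ ((s.2 0 = 1 /\ P x) \/ (s.2 0 = 0 /\ ~ P x)).

Definition decidable_problem (X : Type) (enc : X -> nat) (D : X -> Prop)
    (P : X -> Prop) : Prop :=
  exists M : rm, rm_decides enc D P M.

Definition crasp_instance := (nat * program)%type.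
Definition crasp_enc (x : crasp_instance) : nat := enc_instance x.1 x.2.
Definition crasp_wf (x : crasp_instance) : Prop := wf_program x.1 x.2.
Definition crasp_empty (x : crasp_instance) : Prop := lang_empty x.1 x.2.

(* Main.v *)
Require Import Defs.
From mathcomp Require Import all_boot all_order all_algebra.
From mathcomp Require Import zify.
From Stdlib Require Import FunctionalExtensionality.
Set Implicit Arguments. Unset Strict Implicit. Unset Printing Implicit Defensive.

(* A run of a register machine N on input x is written as the word 0^x followed by one
   letter per executed instruction and branch taken. The program counter and every
   register then change by an amount that depends only on the letter, so after each prefix
   they are linear combinations of letter counts; a C-RASP program can therefore check
   every step, and it has a word exactly when N halts on x.

   Only one node of that program, "the number of letters 0 is x", depends on x. Let x code
   the other nodes; since it is the tail of the coded list, the code of the whole program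
   is an explicit iterated pairing of constants and x, computed by a small register
   machine. Given a decider M for emptiness, let N compute this code from x, run M on it,
   and halt iff M answers "empty". If x codes the nodes for this N, then N halts on x iff
   its program is empty, that is, iff N does not halt on x. *)

(** * Structured programs for register machines *)

Definition reach (N : rm) (s s' : rstate) : Prop := exists n, rm_run N n s = s'.

Lemma reach_refl N s : reach N s s.
Proof. by exists 0. Qed.

Lemma reach_trans N s1 s2 s3 : reach N s1 s2 -> reach N s2 s3 -> reach N s1 s3.
Proof. by move=> [m <-] [n <-]; exists (n + m); rewrite /rm_run iterD. Qed.

Lemma reach_step N s : reach N s (rm_step N s).
Proof. by exists 1. Qed.

Lemma iter_rm_step_halted N n s : rm_halted N s -> rm_run N n s = s.
Proof.
move=> Hs; elim: n => [|n IHn] //; rewrite /rm_run iterS -/(rm_run N n s) IHn.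
by case: s Hs {IHn} => pc f; rewrite /rm_halted /= leqNgt => /negPf ->.
Qed.

(** Halting persists, so a halt before [s'] would make [s'] halted; from [s'] on the run is
    constant. *)
Lemma reach_fixpoint_not_halted N s s' :
  reach N s s' -> rm_step N s' = s' -> ~~ rm_halted N s' ->
  forall n, ~~ rm_halted N (rm_run N n s).
Proof.
move=> [m <-] Hfix Hnh n; case: (leqP m n) => [le_mn | lt_nm].
  rewrite -(subnK le_mn) /rm_run iterD; elim: (n - m) => [|d IHd] //.
  suff ->: iter d.+1 (rm_step N) (iter m (rm_step N) s) = iter m (rm_step N) s by [].
  by elim: d {IHd} => //= d ->.
apply: contra Hnh => Hn.
by rewrite -(subnK (ltnW lt_nm)) /rm_run iterD -/(rm_run N n s) -/(rm_run N _ _)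
  iter_rm_step_halted.
Qed.

Definition code_at (N : rm) (o : nat) (c : rm) : Prop :=
  exists pre post, N = pre ++ c ++ post /\ size pre = o.

Lemma code_at_catl N o c1 c2 : code_at N o (c1 ++ c2) -> code_at N o c1.
Proof. by move=> [a [b [-> <-]]]; exists a, (c2 ++ b); rewrite !catA. Qed.

Lemma code_at_catr N o c1 c2 : code_at N o (c1 ++ c2) -> code_at N (o + size c1) c2.
Proof. by move=> [a [b [-> <-]]]; exists (a ++ c1), b; rewrite !catA size_cat. Qed.

Lemma code_at_nth N o c i : code_at N o c -> i < size c ->
  (o + i < size N) /\ nth (Inc 0) N (o + i) = nth (Inc 0) c i.
Proof.
move=> [a [b [-> <-]]] lt_i; rewrite !size_cat; split; first lia.
by rewrite nth_cat ltnNge leq_addr /= addKn nth_cat lt_i.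
Qed.

Inductive cmd := CSkip | CInc of nat | CSeq of cmd & cmd | CWhile of nat & cmd.

Inductive exec : cmd -> (nat -> nat) -> (nat -> nat) -> Prop :=
  | ExecSkip f : exec CSkip f f
  | ExecInc r f : exec (CInc r) f (upd f r (f r).+1)
  | ExecSeq c d f g h : exec c f g -> exec d g h -> exec (CSeq c d) f h
  | ExecDone r c f : f r = 0 -> exec (CWhile r c) f f
  | ExecLoop r c f g h : f r <> 0 -> exec c (upd f r (f r).-1) g ->
      exec (CWhile r c) g h -> exec (CWhile r c) f h.

Fixpoint avoids (z : nat) (c : cmd) : bool :=
  match c with
  | CSkip => true
  | CInc r => r != z
  | CSeq c d => avoids z c && avoids z d
  | CWhile r c => (r != z) && avoids z c
  end.

(* Register [z] stays 0, so [Dec z o] is an unconditional jump to [o]. *)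
Fixpoint compile (z : nat) (c : cmd) (o : nat) : rm :=
  match c with
  | CSkip => [::]
  | CInc r => [:: Inc r]
  | CSeq c d => let C := compile z c o in C ++ compile z d (o + size C)
  | CWhile r c => let C := compile z c o.+1 in
      Dec r (o + (size C).+2) :: C ++ [:: Dec z o]
  end.

(** Induction on the derivation of [exec]: after one pass the closing jump returns to offset [o],
    where the hypothesis for the remaining passes applies. *)
Lemma compile_correct z c f g : exec c f g -> avoids z c -> f z = 0 ->
  forall N o, code_at N o (compile z c o) ->
  g z = 0 /\ reach N (o, f) (o + size (compile z c o), g).
Proof.
elim=> {c f g} [f | r f | c d f g h _ IHc _ IHd | r c f fr0 | r c f g h fr _ IHc _ IHw] /=.
- by move=> _ fz N o _; rewrite addn0; split => //; apply: reach_refl.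
- move=> rz fz N o HC; split; first by rewrite /upd eq_sym (negPf rz).
  have [lt_o eq_o] := code_at_nth HC (isT : 0 < 1).
  by exists 1; move: lt_o eq_o; rewrite addn0 addn1 /= => -> ->.
- case/andP=> Hc Hd fz N o HC.
  have [gz R1] := IHc Hc fz N o (code_at_catl HC).
  have [hz R2] := IHd Hd gz N _ (code_at_catr HC).
  by split => //; apply: reach_trans R1 _; rewrite size_cat addnA.
- case/andP=> rz Hc fz N o HC; split=> //.
  have [lt_o eq_o] := code_at_nth HC (isT : 0 < _.+1).
  exists 1; move: lt_o eq_o; rewrite addn0 /= => -> -> /=.
  by rewrite fr0 eqxx size_cat addn1.
case/andP=> rz Hc fz N o HC.
have fz' : upd f r (f r).-1 z = 0 by rewrite /upd eq_sym (negPf rz).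
have HC1 := HC; rewrite -cat1s in HC1.
have HC2 := code_at_catr HC1; rewrite /= addn1 in HC2.
have [gz R1] := IHc Hc fz' N o.+1 (code_at_catl HC2).
have rzc : (r != z) && avoids z c by rewrite rz.
have [hz R2] := IHw rzc gz N o HC.
split=> //; have [lt_o eq_o] := code_at_nth HC (isT : 0 < _.+1).
have E1 : rm_step N (o, f) = (o.+1, upd f r (f r).-1).
  by move: lt_o eq_o; rewrite addn0 /= => -> -> /=; case: eqP fr.
apply: reach_trans (reach_step _ _) _; rewrite E1.
apply: reach_trans R1 _; apply: reach_trans (reach_step _ _) _.
have [lt_j eq_j] := code_at_nth (code_at_catr HC2) (isT : 0 < 1).
by move: lt_j eq_j; rewrite addn0 /= => -> -> /=; rewrite gz.
Qed.

(** * Transfers, Cantor pairing and the diagonal code on registers *)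

Definition adds (rs : seq nat) : cmd := foldr (fun r => CSeq (CInc r)) CSkip rs.

Lemma exec_adds rs f : exec (adds rs) f (fun i => f i + count_mem i rs).
Proof.
elim: rs f => [|r rs IHrs] f /=.
  have -> : (fun i => f i + 0) = f by apply: functional_extensionality => i; rewrite addn0.
  exact: ExecSkip.
apply: ExecSeq (ExecInc _ _) _.
rewrite (_ : (fun i => _) = fun i => upd f r (f r).+1 i + count_mem i rs); first exact: IHrs.
apply: functional_extensionality => i; rewrite /upd [r == i]eq_sym; case: eqP => [->|_] //=.
by rewrite add1n addnS.
Qed.

Definition transfer (r : nat) (rs : seq nat) : cmd := CWhile r (adds rs).

Lemma exec_transfer r rs f g : r \notin rs ->
  (forall i, g i = if i == r then 0 else f i + count_mem i rs * f r) ->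
  exec (transfer r rs) f g.
Proof.
move=> r_rs; have c0 : count_mem r rs = 0 by apply/count_memPn.
move Dn: (f r) => n; elim: n f Dn => [|n IHn] f Dn Hg.
  rewrite (_ : g = f); first exact: ExecDone.
  by apply: functional_extensionality => i; rewrite Hg muln0 addn0; case: eqP => [->|_].
apply: ExecLoop (exec_adds _ _) _; first by rewrite Dn.
apply: IHn; first by rewrite /upd eqxx Dn c0 addn0.
by move=> i; rewrite Hg /upd; case: eqP => // _; lia.
Qed.

(** Register 0 holds the input and finally the output, 1 and 2 the arguments of a pairing with its
    result in 2; 3 and 4 are scratch, and 5 saves the input. Register 6 is left for unconditional
    jumps. *)
Definition regs (a b c d e f : nat) : nat -> nat := nth 0 [:: a; b; c; d; e; f].

Ltac exec_concrete := by case=> [|[|[|[|[|[|i]]]]]]; rewrite /upd /regs /= -?muln2; lia.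

(** With s > 0 in register 3, a pass adds s to register 2 and leaves s - 1 in register 3, restored
    from the copy in register 1. The total is the triangular number in the pairing function. *)
Definition triangle : cmd :=
  CWhile 3 (CSeq (CInc 2) (CSeq (transfer 3 [:: 1; 2]) (transfer 1 [:: 3]))).

Lemma exec_triangle x v s y :
  exec triangle (regs x 0 v s 0 y) (regs x 0 (v + (s * s.+1) %/ 2) 0 0 y).
Proof.
elim: s v => [|s IHs] v; first by rewrite div0n addn0; apply: ExecDone.
apply: ExecLoop; first by [].
  apply: ExecSeq (ExecInc _ _) _.
  apply: (ExecSeq (g := regs x s (v.+1 + s) 0 0 y)).
    apply: exec_transfer => //; exec_concrete.
  apply: (exec_transfer (g := regs x 0 (v.+1 + s) s 0 y)) => //; exec_concrete.
rewrite (_ : v + _ = v.+1 + s + (s * s.+1) %/ 2) //.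
(* The multiple of 2 is split off so that it can leave the division. *)
rewrite (_ : s.+1 * s.+2 = s.+1 * 2 + s * s.+1); last by lia.
by rewrite divnMDl //; lia.
Qed.

Definition pairing : cmd :=
  CSeq (transfer 1 [:: 3]) (CSeq (transfer 2 [:: 3; 4]) (CSeq (transfer 4 [:: 2]) triangle)).

Lemma exec_pairing x u v y :
  exec pairing (regs x u v 0 0 y) (regs x 0 (npair u v) 0 0 y).
Proof.
apply: (ExecSeq (g := regs x 0 v u 0 y)); first by apply: exec_transfer => //; exec_concrete.
apply: (ExecSeq (g := regs x 0 0 (u + v) v y)); first by apply: exec_transfer => //; exec_concrete.
apply: (ExecSeq (g := regs x 0 v (u + v) 0 y)); first by apply: exec_transfer => //; exec_concrete.
by rewrite /npair [_ %/ _ + _]addnC; apply: exec_triangle.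
Qed.

Definition pairing_const (n : nat) : cmd := CSeq (adds (nseq n 1)) pairing.

Lemma exec_pairing_const n x v y :
  exec (pairing_const n) (regs x 0 v 0 0 y) (regs x 0 (npair n v) 0 0 y).
Proof.
apply: ExecSeq (exec_adds _ _) _.
rewrite (_ : (fun i => _) = regs x n v 0 0 y); first exact: exec_pairing.
apply: functional_extensionality; case=> [|[|[|[|[|[|i]]]]]] /=;
  rewrite /regs count_nseq /= ?nth_nil ?mul1n ?mul0n; lia.
Qed.

(** The outer [x] is the alphabet size, the inner one the tail of the node list. Further, 0 codes
    [NLetter 0], 5 is the tag of [NCmp], 7 codes the list [[:: (1, TCount 0)]], 2 codes [CEq], and
    [x.*2] codes the integer [x]. *)
Definition diag_code (x : nat) : nat :=
  npair x (npair 0 (npair (npair 5 (npair 7 (npair 2 x.*2))) x).+1).+1.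

Definition diag_cmd : cmd :=
  CSeq (transfer 0 [:: 5; 2; 2])
  (CSeq (pairing_const 2) (CSeq (pairing_const 7) (CSeq (pairing_const 5)
  (CSeq (transfer 2 [:: 1]) (CSeq (transfer 5 [:: 0; 2]) (CSeq pairing (CSeq (CInc 2)
  (CSeq (pairing_const 0) (CSeq (CInc 2) (CSeq (transfer 0 [:: 1]) (CSeq pairing
  (transfer 2 [:: 0])))))))))))).

Lemma exec_inc2 x v : exec (CInc 2) (regs x 0 v 0 0 0) (regs x 0 v.+1 0 0 0).
Proof.
rewrite (_ : regs x 0 v.+1 0 0 0 = upd (regs x 0 v 0 0 0) 2 v.+1); first exact: ExecInc.
by apply: functional_extensionality; case=> [|[|[|i]]].
Qed.

(** All other registers end at 0, so that the decider can start from [rm_init (diag_code x)]. *)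
Lemma exec_diag x : exec diag_cmd (regs x 0 0 0 0 0) (regs (diag_code x) 0 0 0 0 0).
Proof.
rewrite /diag_code.
(* Listing register 2 twice doubles [x]; pairing then proceeds from the innermost pair outwards. *)
apply: (ExecSeq (g := regs 0 0 x.*2 0 0 x)); first by apply: exec_transfer => //; exec_concrete.
do 3 apply: ExecSeq (exec_pairing_const _ _ _ _) _.
set y := npair 5 _.
apply: (ExecSeq (g := regs 0 y 0 0 0 x)); first by apply: exec_transfer => //; exec_concrete.
apply: (ExecSeq (g := regs x y x 0 0 0)); first by apply: exec_transfer => //; exec_concrete.
apply: ExecSeq (exec_pairing _ _ _ _) _.
apply: ExecSeq (exec_inc2 _ _) _.
apply: ExecSeq (exec_pairing_const _ _ _ _) _.
apply: ExecSeq (exec_inc2 _ _) _.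
set y' := (npair 0 _).+1.
apply: (ExecSeq (g := regs 0 x y' 0 0 0)); first by apply: exec_transfer => //; exec_concrete.
apply: ExecSeq (exec_pairing _ _ _ _) _.
apply: exec_transfer => //; exec_concrete.
Qed.

(** * Relocated code and the diagonal machine *)

(* Jumps are truncated at [size M], so that every halting run of [M] ends right after its
   relocated code. *)
Definition relocate (o : nat) (M : rm) : rm :=
  [seq match i with Inc r => Inc r | Dec r j => Dec r (o + minn j (size M)) end | i <- M].

Lemma relocate_step N o M pc f : code_at N o (relocate o M) ->
  pc < size M ->
  rm_step N (o + pc, f) =
    (o + minn (rm_step M (pc, f)).1 (size M), (rm_step M (pc, f)).2).
Proof.
move=> HN lt_pc; have := @code_at_nth _ _ _ pc HN; rewrite size_map => /(_ lt_pc) [lt_N eq_N].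
rewrite /rm_step lt_N eq_N lt_pc (nth_map (Inc 0)) //.
by case: (nth _ M pc) => [r | r j]; rewrite -?addnS /=; [|case: eqP => _ /=];
  rewrite ?(minn_idPl lt_pc).
Qed.

Lemma relocate_reach N o M n s : code_at N o (relocate o M) ->
  reach N (o + minn s.1 (size M), s.2)
    (o + minn (rm_run M n s).1 (size M), (rm_run M n s).2).
Proof.
move=> HN; elim: n => [|n IHn]; first exact: reach_refl.
apply: reach_trans IHn _; rewrite /rm_run iterS.
case: (iter n _ s) => pc f; have [lt_pc | le_pc] := ltnP pc (size M).
  by rewrite -(relocate_step _ HN lt_pc); apply: reach_step.
rewrite /rm_step ltnNge le_pc /= (minn_idPr le_pc); exact: reach_refl.
Qed.

(* The last instruction jumps to itself forever when [M] has answered 0. *)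
Definition halt_iff_one (P M : rm) : rm :=
  P ++ relocate (size P) M ++ [:: Dec 0 (size P + size M)].

Lemma size_halt_iff_one P M : size (halt_iff_one P M) = (size P + size M).+1.
Proof. by rewrite !size_cat size_map addn1 addnS. Qed.

Lemma halt_iff_one_last P M f :
  rm_step (halt_iff_one P M) (size P + size M, f) =
    if f 0 == 0 then (size P + size M, f) else ((size P + size M).+1, upd f 0 (f 0).-1).
Proof.
rewrite /= size_halt_iff_one ltnSn /halt_iff_one catA nth_cat size_cat size_map.
by rewrite ltnn subnn.
Qed.

Definition diag_machine (M : rm) : rm := halt_iff_one (compile 6 diag_cmd 0) M.

Lemma regs_init x : rm_init x = (0, regs x 0 0 0 0 0).
Proof. by congr pair; apply: functional_extensionality; case=> [|[|[|[|[|[|[|i]]]]]]]. Qed.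

Lemma diag_machine_reach M x n :
  let s := rm_run M n (rm_init (diag_code x)) in
  rm_halted M s ->
  reach (diag_machine M) (rm_init x) (size (compile 6 diag_cmd 0) + size M, s.2).
Proof.
move=> s Hs; rewrite /diag_machine; set P := compile _ _ _; set Q := relocate (size P) M.
set N := halt_iff_one P M.
have HP : code_at N 0 P by exists [::], (Q ++ [:: Dec 0 (size P + size M)]).
have HQ : code_at N (size P) Q by exists P, [:: Dec 0 (size P + size M)].
have [_ R1] := compile_correct (exec_diag x) (isT : avoids 6 diag_cmd) (erefl 0) HP.
rewrite add0n -/P in R1; clearbody P.
rewrite regs_init; apply: reach_trans R1 _.
have := relocate_reach n (rm_init (diag_code x)) HQ.
by rewrite (minn_idPr Hs) -/s regs_init min0n addn0.
Qed.

Lemma diag_machine_halts M x n :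
  let s := rm_run M n (rm_init (diag_code x)) in
  rm_halted M s ->
  (s.2 0 = 1 -> exists m, rm_halted (diag_machine M) (rm_run (diag_machine M) m (rm_init x))) /\
  (s.2 0 = 0 -> forall m, ~~ rm_halted (diag_machine M) (rm_run (diag_machine M) m (rm_init x))).
Proof.
move=> s Hs; have := diag_machine_reach Hs; rewrite -/s /diag_machine.
set P := compile _ _ _; clearbody P => R; set N := halt_iff_one P M.
have last_step := halt_iff_one_last P M s.2.
split=> s0; rewrite s0 ?eqxx in last_step.
  have [m E] := reach_trans R (reach_step _ _).
  by exists m; rewrite E last_step /rm_halted size_halt_iff_one.
apply: reach_fixpoint_not_halted R last_step _.
by rewrite /rm_halted size_halt_iff_one -ltnNge.
Qed.

Import Order.TTheory GRing.Theory Num.Theory.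

(** * Node semantics of C-RASP programs *)

Lemma program_env_rcons p nd w :
  program_env (rcons p nd) w =
    rcons (program_env p w) (node_eval w (program_env p w) nd).
Proof. exact: foldl_rcons. Qed.

Lemma size_program_env p w : size (program_env p w) = size p.
Proof.
by elim/last_ind: p => [|p nd IHp] //; rewrite program_env_rcons !size_rcons IHp.
Qed.

Lemma eq_term_eval e1 e2 j t i : term_ok j t ->
  (forall j', j' < j -> getv e1 j' = getv e2 j') -> term_eval e1 t i = term_eval e2 t i.
Proof. by case: t => [j'|c] //= lt_j ->. Qed.

Lemma eq_node_eval w e1 e2 k j nd : node_ok k j nd ->
  (forall j', j' < j -> getv e1 j' = getv e2 j') -> node_eval w e1 nd = node_eval w e2 nd.
Proof.
move=> ok_nd eq_e; apply: functional_extensionality => i.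
case: nd ok_nd => [a|j'|j'|j'|j1 j2|ts c z] /=; first by [].
- by move=> /eq_e ->.
- by move=> /eq_e ->.
- by move=> /eq_e ->.
- by case/andP=> /eq_e -> /eq_e ->.
move=> ok_ts; congr cmp_eval; elim: ts ok_ts => [|tc ts IHts] /=.
  by rewrite !big_nil.
case/andP=> ok_tc /IHts; rewrite !big_cons => ->; congr (_ * _ + _)%R.
exact: eq_term_eval ok_tc eq_e.
Qed.

(** A well-formed node reads only earlier values, which later nodes do not change, so it may be
    evaluated in the final environment. *)
Lemma getv_program_env k p w j :
  all (fun j => node_ok k j (nth (NLetter 0) p j)) (iota 0 (size p)) -> j < size p ->
  getv (program_env p w) j = node_eval w (program_env p w) (nth (NLetter 0) p j).
Proof.
elim/last_ind: p j => [|p nd IHp] // j; rewrite size_rcons -addn1 iotaD all_cat /= andbT.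
rewrite add0n nth_rcons ltnn eqxx program_env_rcons addn1 ltnS leq_eqVlt.
case/andP=> ok_p ok_nd lt_j; set e := program_env p w; set e' := rcons _ _.
have ok_p' : all (fun j => node_ok k j (nth (NLetter 0) p j)) (iota 0 (size p)).
  apply/allP=> i in_i; have := allP ok_p _ in_i.
  by rewrite nth_rcons; move: in_i; rewrite mem_iota add0n => /= ->.
have eq_e : forall j', j' < size p -> getv e j' = getv e' j'.
  by move=> j' lt_j'; rewrite /getv /e' nth_rcons size_program_env lt_j'.
case/predU1P: lt_j => [-> | lt_j].
  rewrite nth_rcons ltnn eqxx /getv /e' nth_rcons size_program_env ltnn eqxx.
  exact: eq_node_eval ok_nd eq_e.
rewrite nth_rcons lt_j -eq_e // IHp //.
have ok_j : node_ok k j (nth (NLetter 0) p j) by apply: (allP ok_p'); rewrite mem_iota.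
by apply: eq_node_eval ok_j _ => j' lt_j'; apply: eq_e; apply: ltn_trans lt_j.
Qed.

(** * Register machine runs as words *)

(* The state (pc, regs) changes to (dst, regs[reg += delta]), provided that pc = src
   and that the new value of reg compares to 0 as required by [test]. *)
Record move := Move { src : nat; dst : nat; reg : nat; delta : int; test : cmpop }.

(* Letter 0 increments the input register 0; letters 2j+1 and 2j+2 execute instruction j
   (for [Dec], the decrement and the jump respectively; for [Inc], both increment). *)
Definition nletters (N : rm) : nat := (size N).*2.+1.

(** As tests see the new value, [CGe] admits a decrement exactly when the register was positive. *)
Definition letter_move (N : rm) (b : nat) : move :=
  if b is c.+1 then
    match nth (Inc 0) N c./2 with
    | Inc r => Move c./2 c./2.+1 r 1 CGe
    | Dec r j => if odd c then Move c./2 j r 0 CEq else Move c./2 c./2.+1 r (-1) CGe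
    end
  else Move 0 0 0 1 CGe.

Definition pc_weight (N : rm) (b : nat) : int :=
  ((dst (letter_move N b))%:Z - (src (letter_move N b))%:Z)%R.

Definition reg_weight (N : rm) (r b : nat) : int :=
  if reg (letter_move N b) == r then delta (letter_move N b) else 0%R.

(** The total of [d] along [u], written through letter counts because these are what C-RASP terms
    measure. *)
Definition weight (L : nat) (d : nat -> int) (u : seq nat) : int :=
  (\sum_(b <- iota 0 L) d b * (count_mem b u)%:Z)%R.

Lemma weight_rcons L d u c :
  weight L d (rcons u c) = (weight L d u + (if (c < L)%N then d c else 0))%R.
Proof.
rewrite /weight; under eq_bigr => b _ do
  rewrite -cats1 count_cat /= addn0 PoszD mulrDr.
rewrite big_split /=; congr (_ + _)%R.
case: ltnP => [lt_c | le_c].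
  rewrite (bigD1_seq c) ?iota_uniq ?mem_iota //= eqxx mulr1 big1 ?addr0 //.
  by move=> b; rewrite eq_sym => /negPf ->; rewrite mulr0.
rewrite big_seq big1 // => b; rewrite mem_iota add0n /= => lt_b.
by rewrite gtn_eqF ?mulr0 //; apply: leq_trans le_c.
Qed.

(** In [trace] the prefix [u] ends with [b], which contributes [dst - src] to the counter; comparing
    with [dst] thus forces the counter before [b] to be [src]. The last conjunct asks that the input
    be complete by then. *)
Definition move_ok (N : rm) (x : nat) (u : seq nat) (b : nat) : bool :=
  let L := nletters N in let m := letter_move N b in
  [&& weight L (pc_weight N) u == Posz (dst m),
      cmp_eval (test m) (weight L (reg_weight N (reg m)) u) 0 & count_mem 0 u == x].

Definition trace (N : rm) (x : nat) (w : seq nat) : Prop :=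
  forall i, i < size w -> 0 < nth 0 w i < nletters N ->
    move_ok N x (take i.+1 w) (nth 0 w i).

Lemma trace_rcons N x w c :
  trace N x (rcons w c) <->
  trace N x w /\ (0 < c < nletters N -> move_ok N x (rcons w c) c).
Proof.
split=> [tr | [tr ok_c] i].
  split=> [i lt_i | ok_c].
    have := tr i; rewrite size_rcons nth_rcons lt_i -cats1 takel_cat //.
    by apply; apply: ltnW.
  have := tr (size w); rewrite size_rcons nth_rcons ltnn eqxx take_oversize ?size_rcons //.
  by apply.
rewrite size_rcons ltnS leq_eqVlt => /predU1P[-> | lt_i].
  by rewrite nth_rcons ltnn eqxx take_oversize ?size_rcons //.
by rewrite nth_rcons lt_i -cats1 takel_cat //; apply: tr.
Qed.

Definition matches (N : rm) (u : seq nat) (s : rstate) : Prop :=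
  weight (nletters N) (pc_weight N) u = s.1 /\
  forall r, weight (nletters N) (reg_weight N r) u = s.2 r.

Lemma odd_half_nletters N b : 0 < b < nletters N -> b.-1./2 < size N.
Proof. by rewrite /nletters; case: b => //= b; lia. Qed.

Lemma matches_sound N x u b s : matches N u s -> 0 < b < nletters N ->
  move_ok N x (rcons u b) b -> matches N (rcons u b) (rm_step N s).
Proof.
case: s => pc f [/= Hpc Hr] lt_b; rewrite /move_ok => /and3P[].
have lt_j := odd_half_nletters lt_b; case/andP: lt_b => b_gt0 lt_b.
rewrite !weight_rcons lt_b Hpc Hr => Hp Ht _.
have Epc : pc = src (letter_move N b) by move: Hp; rewrite /pc_weight; lia.
move: Hp Ht Epc; rewrite /pc_weight /reg_weight eqxx.
case: b b_gt0 lt_b lt_j => // c _ lt_b /= lt_j; case Ei: (nth _ N _) => [r | r j].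
  move=> /= _ _ Epc; rewrite Epc lt_j Ei; split=> [|r']; rewrite weight_rcons lt_b.
    by rewrite Hpc /pc_weight /= Ei /=; lia.
  by rewrite Hr /reg_weight /= Ei /= /upd eq_sym; case: eqP => [->|_]; lia.
case Eo: (odd c) => /= Hp Ht Epc; rewrite Epc lt_j Ei.
  have fr0 : f r = 0 by lia.
  rewrite fr0 /=; split=> [|r']; rewrite weight_rcons lt_b.
    by rewrite Hpc /pc_weight /= Ei Eo /=; lia.
  by rewrite Hr /reg_weight /= Ei Eo /=; case: eqP => _; lia.
have fr0 : 0 < f r by lia.
rewrite (gtn_eqF fr0) /=; split=> [|r']; rewrite weight_rcons lt_b.
  by rewrite Hpc /pc_weight /= Ei Eo /=; lia.
by rewrite Hr /reg_weight /= Ei Eo /= /upd eq_sym; case: eqP => [->|_]; lia.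
Qed.

Lemma matches_complete N x u s : matches N u s -> ~~ rm_halted N s -> count_mem 0 u = x ->
  exists2 b, 0 < b < nletters N & move_ok N x (rcons u b) b.
Proof.
case: s => pc f [/= Hpc Hr]; rewrite /rm_halted -ltnNge /= => lt_pc Hx.
(* The bit [c] selects the jump letter, which is needed only for a [Dec] on an empty register. *)
pose c := if nth (Inc 0) N pc is Dec r _ then (f r == 0) else false.
have lt_b : (c + pc.*2).+1 < nletters N by rewrite /nletters; case: (c); lia.
exists (c + pc.*2).+1; first by [].
rewrite /move_ok !weight_rcons lt_b Hpc Hr -cats1 count_cat Hx /= !addn0 eqxx andbT.
rewrite /pc_weight /reg_weight eqxx /= half_bit_double oddD odd_double addbF oddb.
clear lt_b; rewrite {}/c; case: (nth _ N pc) => [r | r j] /=; first by apply/andP; split; lia.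
by case: (f r =P 0) => /= Hf; apply/andP; split; lia.
Qed.

Lemma matches_nil N : matches N [::] (rm_init 0).
Proof.
have w0 d : weight (nletters N) d [::] = 0%R by rewrite /weight big1 // => b _; rewrite mulr0.
by split=> [|[|r]] /=; rewrite w0.
Qed.

Lemma matches_rcons0 N u x : matches N u (rm_init x) -> matches N (rcons u 0) (rm_init x.+1).
Proof.
case=> Hpc Hr; split=> [|r]; rewrite weight_rcons /= ?Hpc ?Hr //.
by rewrite /reg_weight /= eq_sym; case: eqP => _; lia.
Qed.

Lemma matches_rcons_skip N u b s :
  nletters N <= b -> matches N u s -> matches N (rcons u b) s.
Proof.
by move=> le_b [Hpc Hr]; split=> [|r]; rewrite weight_rcons ltnNge le_b /= addr0.
Qed.

Lemma count_mem_rcons (a b : nat) u : count_mem a (rcons u b) = count_mem a u + (b == a).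
Proof. by rewrite -cats1 count_cat /= addn0. Qed.

(** The second conjunct is the invariant: either all [x] zeros have been read, and the bound
    excludes another one, or no instruction has been executed yet. *)
Lemma trace_sound N x w : trace N x w -> count_mem 0 w <= x ->
  exists n, matches N w (rm_run N n (rm_init (count_mem 0 w))) /\
    (count_mem 0 w = x \/ n = 0).
Proof.
elim/last_ind: w => [|w b IHw]; first by exists 0; split; [apply: matches_nil | right].
case/trace_rcons=> tr_w; rewrite count_mem_rcons => ok_b le_x.
have [n [Hn Hx]] := IHw tr_w (leq_trans (leq_addr _ _) le_x).
case: b ok_b le_x => [|b] ok_b le_x.
  case: Hx => [Hx | n0]; first by rewrite Hx /= addn1 ltnn in le_x.
  rewrite n0 in Hn; exists 0; split; last by right.
  by rewrite addn1; apply: matches_rcons0.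
rewrite addn0; case: (ltnP b.+1 (nletters N)) ok_b => [lt_b | le_b] ok_b; last first.
  by exists n; split=> //; apply: matches_rcons_skip.
have ok := ok_b isT; exists n.+1; split.
  by rewrite /rm_run iterS; apply: matches_sound ok.
by left; move: ok => /and3P[_ _]; rewrite count_mem_rcons addn0 => /eqP.
Qed.

Lemma trace_complete N x n :
  exists w, [/\ trace N x w, matches N w (rm_run N n (rm_init x)), count_mem 0 w = x &
                all (ltn^~ (nletters N)) w].
Proof.
elim: n => [|n [w [tr_w Hw Hx lt_w]]].
  suff [w [tr_w Hw Hx lt_w]] : exists w, [/\ trace N x w, matches N w (rm_init x),
    count_mem 0 w = x & all (ltn^~ (nletters N)) w] by exists w.
  (* The induction is on the number of zeros written; the [x] in [trace] stays fixed. *)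
  elim: {2 3}x => [|y [w [tr_w Hw Hx lt_w]]]; first by exists [::]; split=> //; apply: matches_nil.
  exists (rcons w 0); split; first by apply/trace_rcons.
  - exact: matches_rcons0.
  - by rewrite count_mem_rcons Hx addn1.
  by rewrite all_rcons lt_w.
have [Hs | Hs] := boolP (rm_halted N (rm_run N n (rm_init x))).
  exists w; split=> //; rewrite /rm_run iterS -/(rm_run N n _).
  by rewrite (iter_rm_step_halted 1 Hs : rm_step _ _ = _).
have [b lt_b ok_b] := matches_complete Hw Hs Hx.
exists (rcons w b); split; first by apply/trace_rcons.
- by rewrite /rm_run iterS; apply: matches_sound Hw lt_b ok_b.
- by rewrite count_mem_rcons Hx; case: b lt_b {ok_b} => // b _; rewrite addn0.
by rewrite all_rcons lt_w andbT; case/andP: lt_b.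
Qed.

Lemma halting_trace N x :
  (exists n, rm_halted N (rm_run N n (rm_init x))) ->
  exists w, [/\ trace N x w, (Posz (size N) <= weight (nletters N) (pc_weight N) w)%R,
    count_mem 0 w = x & all (ltn^~ (nletters N)) w].
Proof.
case=> n Hn; have [w [tr_w [Hpc _] Hx lt_w]] := trace_complete N x n.
by exists w; split=> //; rewrite Hpc lez_nat.
Qed.

Lemma trace_halting N x w : trace N x w ->
  (Posz (size N) <= weight (nletters N) (pc_weight N) w)%R -> count_mem 0 w = x ->
  exists n, rm_halted N (rm_run N n (rm_init x)).
Proof.
move=> tr_w Hpc Hx; have [|n [[Hn _] _]] := trace_sound tr_w; first by rewrite Hx.
by exists n; rewrite Hn Hx lez_nat in Hpc.
Qed.

(** * The C-RASP program of a register machine *)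

(* For each letter [b < L], node [node_index L t b] of layer [t] states:
   0: the current letter is [b];  4: [move_ok] holds of [b] and the prefix read so far;
   6: the current letter is [b] but [move_ok] fails. *)
Definition node_index (L t b : nat) : nat := 2 + t * L + b.

Definition weight_terms (L : nat) (d : nat -> int) : seq (int * cterm) :=
  [seq (d b, TCount (node_index L 0 b)) | b <- iota 0 L].

Definition layer (N : rm) (t b : nat) : node :=
  let L := nletters N in let m := letter_move N b in
  match t with
  | 0 => NLetter b
  | 1 => NCmp (weight_terms L (pc_weight N)) CEq (Posz (dst m))
  | 2 => NCmp (weight_terms L (reg_weight N (reg m))) (test m) 0
  | 3 => NAnd (node_index L 1 b) (node_index L 2 b)
  | 4 => NAnd (node_index L 3 b) 1
  | 5 => NNot (node_index L 4 b)
  | _ => NAnd (node_index L 0 b) (node_index L 5 b)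
  end.

Definition layers (N : rm) : seq node :=
  mkseq (fun i => layer N (i %/ nletters N) (i %% nletters N)) (7 * nletters N).

(** Here [o] is the index of the first node after the layers. The last four nodes say that no
    instruction letter has violated its check, that the counter is past the end, and, with node 1,
    that the input is [x]. *)
Definition halting_nodes (N : rm) : seq node :=
  let L := nletters N in let o := node_index L 7 0 in
  layers N ++
  [:: NCmp [seq (1%R, TCount (node_index L 6 b)) | b <- iota 1 L.-1] CEq 0;
      NCmp (weight_terms L (pc_weight N)) CGe (Posz (size N));
      NAnd o o.+1; NAnd o.+2 1].

(* Only the second node depends on [x]. *)
Definition halting_program (N : rm) (x : nat) : program :=
  NLetter 0 :: NCmp [:: (1%R, TCount 0)] CEq (Posz x) :: halting_nodes N.

Lemma size_halting_nodes N : size (halting_nodes N) = 7 * nletters N + 4.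
Proof. by rewrite size_cat size_mkseq. Qed.

Lemma size_halting_program N x : size (halting_program N x) = 7 * nletters N + 6.
Proof. by rewrite -[LHS]/(size (halting_nodes N)).+2 size_halting_nodes !addnS. Qed.

Lemma nth_halting_layer N x t b : t < 7 -> b < nletters N ->
  nth (NLetter 0) (halting_program N x) (node_index (nletters N) t b) = layer N t b.
Proof.
move=> lt_t lt_b; rewrite /node_index -addnA /= nth_cat size_mkseq.
have lt_i : t * nletters N + b < 7 * nletters N by nia.
have L_gt0 : 0 < nletters N by [].
by rewrite lt_i nth_mkseq // divnMDl // divn_small // addn0 modnMDl modn_small.
Qed.

Lemma nth_halting_last N x i :
  nth (NLetter 0) (halting_program N x) (node_index (nletters N) 7 0 + i) =
  nth (NLetter 0) (drop (7 * nletters N) (halting_nodes N)) i.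
Proof. by rewrite nth_drop /node_index addn0 -addnA. Qed.

Lemma drop_halting_nodes N : let L := nletters N in let o := node_index L 7 0 in
  drop (7 * L) (halting_nodes N) =
  [:: NCmp [seq (1%R, TCount (node_index L 6 b)) | b <- iota 1 L.-1] CEq 0;
      NCmp (weight_terms L (pc_weight N)) CGe (Posz (size N));
      NAnd o o.+1; NAnd o.+2 1].
Proof. by move=> L o; rewrite drop_size_cat ?size_mkseq. Qed.

Lemma all_weight_terms L d j : node_index L 1 0 <= j ->
  all (fun tc => term_ok j tc.2) (weight_terms L d).
Proof.
move=> le_j; rewrite all_map; apply/allP=> b; rewrite mem_iota /= => lt_b.
by move: le_j; rewrite /node_index; lia.
Qed.

Lemma wf_halting_program N x k : nletters N <= k -> wf_program k (halting_program N x).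
Proof.
move=> le_k; have L_gt0 : 0 < nletters N by [].
rewrite /wf_program; apply/andP; split=> //; apply/allP=> j.
rewrite mem_iota add0n size_halting_program => /andP[_ lt_j].
case: j lt_j => [|[|j]] lt_j; first exact: leq_trans le_k.
  by [].
have [lt_L | le_L] := ltnP j (7 * nletters N).
  have Ej : j.+2 = node_index (nletters N) (j %/ nletters N) (j %% nletters N).
    by rewrite /node_index -addnA -divn_eq.
  have lt_t : j %/ nletters N < 7 by rewrite ltn_divLR.
  have := ltn_pmod j L_gt0; rewrite {}Ej.
  move: (j %/ _) (j %% _) lt_t => t b lt_t lt_b; rewrite nth_halting_layer //.
  case: t lt_t => [|[|[|[|[|[|[|t]]]]]]] // _;
    rewrite /layer /node_ok; try by rewrite /node_index; lia.
  - by apply: all_weight_terms; rewrite /node_index; lia.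
  by apply: all_weight_terms; rewrite /node_index; lia.
have Ej : j.+2 = node_index (nletters N) 7 0 + (j - 7 * nletters N).
  by rewrite /node_index; lia.
have : j - 7 * nletters N < 4 by lia.
rewrite Ej nth_halting_last drop_halting_nodes.
move: (j - _) => [|[|[|[|i]]]] // _; rewrite /nth /node_ok; try by rewrite /node_index; lia.
  rewrite all_map; apply/allP=> b; rewrite mem_iota => /andP[b_gt0 lt_b].
  by change (node_index (nletters N) 6 b < node_index (nletters N) 7 0 + 0);
    rewrite /node_index; lia.
by apply: all_weight_terms; rewrite /node_index; lia.
Qed.

Lemma count_letter w e j b i : getv e j = node_eval w e (NLetter b) -> i <= size w ->
  count (getv e j) (iota 1 i) = count_mem b (take i w).
Proof.
move=> Ej; elim: i => [|i IHi] lt_i; first by rewrite take0.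
rewrite -[in X in count _ X](addn1 i) iotaD count_cat IHi ?(ltnW lt_i) // (take_nth 0 lt_i).
by rewrite count_mem_rcons /= addn0 Ej /= add1n lt_i.
Qed.

Section Semantics.
Variables (N : rm) (x : nat) (w : seq nat).
Let L := nletters N.
Let e := program_env (halting_program N x) w.

Lemma getv_halting j : j < size (halting_program N x) ->
  getv e j = node_eval w e (nth (NLetter 0) (halting_program N x) j).
Proof.
by apply: (@getv_program_env L); case/andP: (wf_halting_program x (leqnn L)).
Qed.

Lemma getv_layer t b : t < 7 -> b < L ->
  getv e (node_index L t b) = node_eval w e (layer N t b).
Proof.
move=> lt_t lt_b; rewrite getv_halting ?nth_halting_layer //.
rewrite size_halting_program /node_index -/L; nia.
Qed.

Lemma getv_last i : i < 4 ->
  getv e (node_index L 7 0 + i) =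
  node_eval w e (nth (NLetter 0) (drop (7 * L) (halting_nodes N)) i).
Proof.
move=> lt_i; rewrite getv_halting ?nth_halting_last //.
rewrite size_halting_program /node_index -/L; lia.
Qed.

Lemma weight_terms_eval d i : i <= size w ->
  (\sum_(tc <- weight_terms L d) (tc.1 * term_eval e tc.2 i))%R = weight L d (take i w).
Proof.
move=> le_i; rewrite big_map /weight; apply: eq_big_seq => b.
rewrite mem_iota add0n => /andP[_ lt_b]; congr (_ * Posz _)%R.
by apply: count_letter => //; apply: (@getv_layer 0).
Qed.

Lemma getv_input i : i <= size w -> getv e 1 i = (count_mem 0 (take i w) == x).
Proof.
move=> le_i; rewrite getv_halting //= big_seq1 mul1r /=.
by rewrite (@count_letter w e 0 0) ?getv_halting.
Qed.

Lemma getv_violation b i : b < L -> i <= size w ->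
  getv e (node_index L 6 b) i =
    getv e (node_index L 0 b) i && ~~ move_ok N x (take i w) b.
Proof.
move=> lt_b le_i; rewrite (getv_layer (t := 6)) // {1}/node_eval /layer.
rewrite (getv_layer (t := 5)) // {1}/node_eval /layer.
rewrite (getv_layer (t := 4)) // {1}/node_eval /layer.
rewrite (getv_layer (t := 3)) // {1}/node_eval /layer.
rewrite (getv_layer (t := 2)) // (getv_layer (t := 1)) // /node_eval /layer !weight_terms_eval //.
by rewrite getv_input // /move_ok andbA.
Qed.

Lemma no_violation_trace : getv e (node_index L 7 0) (size w) <-> trace N x w.
Proof.
rewrite -[node_index _ _ _]addn0 getv_last // drop_halting_nodes /nth {1}/node_eval {1}/cmp_eval.
(* Counts are nonnegative, so their sum vanishes only if each of them does. *)
rewrite -/L big_map psumr_eq0; last by move=> b _; rewrite mul1r.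
have letterE b i : b < L -> getv e (node_index L 0 b) i =
    (0 < i) && (i <= size w) && (nth 0 w i.-1 == b).
  by move=> lt_b; rewrite (getv_layer (t := 0)).
split=> [/allP no_viol i lt_i /andP[b_gt0 lt_b] | tr_w].
  have /no_viol : nth 0 w i \in iota 1 L.-1.
    by rewrite mem_iota b_gt0 add1n prednK.
  rewrite implyTb mul1r /term_eval -[0%R]/(Posz 0) eqz_nat -leqn0 leqNgt -has_count => /hasPn.
  (* Positions start at 1, so index [i] of the word is position [i.+1]. *)
  move/(_ i.+1); rewrite mem_iota add1n !ltnS lt_i => /(_ isT).
  by rewrite getv_violation // letterE // lt_i eqxx negbK.
apply/allP=> b; rewrite mem_iota => /andP[b_gt0 lt_b]; apply/eqP.
have {}lt_b : b < L by move: lt_b; rewrite add1n prednK.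
rewrite mul1r /term_eval; congr Posz; apply/eqP; rewrite -leqn0 leqNgt -has_count.
apply/hasPn=> i; rewrite mem_iota add1n ltnS => /andP[i_gt0 le_i].
rewrite getv_violation // letterE // i_gt0 le_i negb_and negbK -implybE.
apply/implyP=> /eqP Eb; have := tr_w i.-1; rewrite prednK // Eb; apply=> //.
by rewrite b_gt0.
Qed.

Lemma accepts_halting_program : accepts (halting_program N x) w <->
  [/\ trace N x w, (Posz (size N) <= weight L (pc_weight N) w)%R & count_mem 0 w = x].
Proof.
rewrite /accepts -/e.
have -> : last (fun _ => false) e = getv e (node_index L 7 0 + 3).
  rewrite /getv -nth_last size_program_env size_halting_program /node_index -/L.
  by congr nth; lia.
rewrite getv_last // drop_halting_nodes /nth {1}/node_eval -/L -[(node_index L 7 0).+2]addn2.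
rewrite getv_last // drop_halting_nodes /nth {1}/node_eval -/L -[(node_index L 7 0).+1]addn1.
rewrite getv_last // drop_halting_nodes /nth {1}/node_eval {1}/cmp_eval -/L.
rewrite weight_terms_eval // getv_input // take_size.
split; first by case/andP=> /andP[/no_violation_trace ? ?] /eqP.
by case=> /no_violation_trace -> -> ->; rewrite eqxx.
Qed.
End Semantics.

(** * The diagonal instance and undecidability *)

(* The code of the nodes that do not depend on the input serves as the input, and also as
   an alphabet size, because it exceeds every letter in use. *)
Definition diag_instance (N : rm) : crasp_instance :=
  let x := enc_list enc_node (halting_nodes N) in (x, halting_program N x).

Lemma diag_instance_enc N :
  crasp_enc (diag_instance N) = diag_code (enc_list enc_node (halting_nodes N)).
Proof. by []. Qed.

(** Every list cell adds at least 1 to the code; hence the code of the nodes exceeds the number of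
    letters. *)
Lemma size_enc_list (T : Type) (e : T -> nat) s : size s <= enc_list e s.
Proof.
by elim: s => //= a s IHs; rewrite ltnS (leq_trans IHs) // /npair leq_addl.
Qed.

Lemma diag_instance_wf N : crasp_wf (diag_instance N).
Proof.
apply: wf_halting_program; apply: leq_trans (size_enc_list _ _).
by rewrite size_halting_nodes; lia.
Qed.

Lemma diag_instance_empty N : let x := enc_list enc_node (halting_nodes N) in
  crasp_empty (diag_instance N) <-> forall n, ~~ rm_halted N (rm_run N n (rm_init x)).
Proof.
move=> x; split=> [Hempty n | no_halt w].
  apply/negP=> Hn.
  have [w [tr_w Hpc Hx lt_w]] := halting_trace (ex_intro _ n Hn).
  have le_L : nletters N <= x.
    by apply: leq_trans (size_enc_list _ _); rewrite size_halting_nodes; lia.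
  (* All letters of the trace are below [nletters N], hence below [x], so it is a word over the
     alphabet of the instance. *)
  have [w' Ew] : exists w' : seq 'I_x, map val w' = w.
    elim: w lt_w {tr_w Hpc Hx} => [|b w IHw] /=; first by exists [::].
    by case/andP=> /leq_trans/(_ le_L) lt_b /IHw[w' <-]; exists (Ordinal lt_b :: w').
  have /negP := Hempty w'; apply; rewrite Ew.
  by apply/accepts_halting_program.
apply/negP=> /accepts_halting_program[tr_w Hpc Hx].
have [n Hn] : exists n, rm_halted N (rm_run N n (rm_init x)).
  exact: trace_halting tr_w Hpc Hx.
by have := no_halt n; rewrite Hn.
Qed.

Theorem theorem3p1 : ~ decidable_problem crasp_enc crasp_wf crasp_empty.
Proof.
case=> M decM; pose N := diag_machine M.
have [n [Hs Hans]] := decM _ (diag_instance_wf N).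
rewrite diag_instance_enc in Hs Hans.
have [halts_of_1 loops_of_0] := diag_machine_halts Hs.
(* Answer 1 makes [N] halt, against emptiness; answer 0 makes [N] run forever, so the language is
   empty after all. *)
case: Hans => -[ans P_ans].
  have [m Hm] := halts_of_1 ans.
  by have /diag_instance_empty/(_ m) := P_ans; rewrite Hm.
by apply: P_ans; apply/diag_instance_empty; apply: loops_of_0.
Qed.
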